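(* Let $Q$ be a superconnected quandle. Then: (i) $\alpha=\mathrm{con}_{\mathrm{Dis}_\alpha}$ and $[\alpha,\beta]=[\beta,\alpha]=\mathrm{con}_{[\mathrm{Dis}_\alpha,\mathrm{Dis}_\beta]}$ for all congruences $\alpha,\beta\in \mathrm{Con}(Q)$. (ii) The mapping $\mathrm{Con}(Q)\to \mathrm{Norm}(Q)$, $\alpha\mapsto \mathrm{Dis}_\alpha$, is injective, and the mapping $\mathrm{Norm}(Q)\to \mathrm{Con}(Q)$, $N\mapsto \mathrm{con}_N$, is surjective.
   Context: A left quasigroup is an algebra $(Q,*,\backslash)$ with two binary operations satisfying $x\backslash(x*y)=y=x*(x\backslash y)$; equivalently every left multiplication $L_a:b\mapsto a*b$ is a bijection of $Q$. A quandle is a left quasigroup satisfying $x*(y*z)=(x*y)*(x*z)$ and $x*x=x$. Subalgebras are subsets closed under $*$ and $\backslash$; congruences are equivalence relations compatible with $*$ and $\backslash$, and $\mathrm{Con}(Q)$ is the lattice of congruences. $\mathrm{LMlt}(Q)=\langle L_a: a\in Q\rangle$ is the left multiplication group. $Q$ is connected if $\mathrm{LMlt}(Q)$ is transitive on $Q$, and superconnected if every subalgebra of $Q$ is connected (with respect to its own left multiplication group). For a congruence $\alpha$, $\mathrm{Dis}_\alpha=\langle hL_aL_b^{-1}h^{-1}: a\,\alpha\,b,\ h\in \mathrm{LMlt}(Q)\rangle$, the smallest normal subgroup of $\mathrm{LMlt}(Q)$ containing all $L_aL_b^{-1}$ with $a\,\alpha\,b$; $\mathrm{Dis}(Q)=\mathrm{Dis}_{1_Q}$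 where $1_Q=Q\times Q$. $\mathrm{Norm}(Q)=\{N\trianglelefteq \mathrm{LMlt}(Q): N\le \mathrm{Dis}(Q)\}$. For $N\in \mathrm{Norm}(Q)$, $\mathrm{con}_N=\{(a,b)\in Q\times Q: L_aL_b^{-1}\in N\}$, which is a congruence of $Q$. $[\mathrm{Dis}_\alpha,\mathrm{Dis}_\beta]$ is the usual group commutator subgroup. For congruences $\alpha,\beta$, $[\alpha,\beta]$ is the commutator of congruences in the sense of Freese and McKenzie: it is the smallest congruence $\delta$ such that for every term $t(x,y_1,\dots,y_n)$ in the operations $*,\backslash$, all $a\,\alpha\,b$ and all $u_i\,\beta\,v_i$ ($1\le i\le n$), $t(a,u_1,\dots,u_n)\,\delta\,t(a,v_1,\dots,v_n)$ implies $t(b,u_1,\dots,u_n)\,\delta\,t(b,v_1,\dots,v_n)$. *)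

(* Defs.v *)
From HB Require Import structures.
From mathcomp Require Import all_boot.
From mathcomp Require Import boolp classical_sets.

Set Implicit Arguments.
Unset Strict Implicit.
Unset Printing Implicit Defensive.

Declare Scope quandle_scope.
Delimit Scope quandle_scope with Q.
Local Open Scope classical_set_scope.
Local Open Scope group_scope.
Local Open Scope quandle_scope.

HB.mixin Record isLeftQuasigroup Q := {
  qmul : Q -> Q -> Q;
  qldiv : Q -> Q -> Q;
  qmulK : forall x y, qldiv x (qmul x y) = y;
  qldivK : forall x y, qmul x (qldiv x y) = y
}.

#[short(type="leftQuasigroupType")]
HB.structure Definition LeftQuasigroup := {Q of isLeftQuasigroup Q}.

Notation "x *q y" := (qmul x y)
  (at level 40, left associativity) : quandle_scope.
Notation "x \q y" := (qldiv x y)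
  (at level 40, left associativity) : quandle_scope.

HB.mixin Record LeftQuasigroup_isQuandle Q of LeftQuasigroup Q := {
  qmul_distr : forall x y z : Q, x *q (y *q z) = (x *q y) *q (x *q z);
  qmul_idem : forall x : Q, x *q x = x
}.

#[short(type="quandleType")]
HB.structure Definition Quandle :=
  {Q of LeftQuasigroup Q & LeftQuasigroup_isQuandle Q}.

Record Sym (T : Type) := MkSym {
  sym_fun :> T -> T;
  sym_inv : T -> T;
  sym_funK : cancel sym_fun sym_inv;
  sym_invK : cancel sym_inv sym_fun
}.

Lemma sym_eq (T : Type) (f g : Sym T) : f =1 g -> f = g.
Proof.
case: f => f f' fK f'K; case: g => g g' gK g'K /= fg.
have E1 : f = g by exact/funext.
have E2 : f' = g' by apply/funext => x; rewrite -{1}(g'K x) -fg fK.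
by subst g g'; congr MkSym; exact: Prop_irrelevance.
Qed.

HB.instance Definition _ (T : Type) := gen_eqMixin (Sym T).
HB.instance Definition _ (T : Type) := gen_choiceMixin (Sym T).

Section SymGroup.
Variable T : Type.

Definition sym_one : Sym T := @MkSym T id id (frefl _) (frefl _).

(* Composition order: [(f * g) x = f (g x)], the opposite of [{perm T}]. *)
Definition sym_mul (f g : Sym T) : Sym T :=
  MkSym (can_comp (sym_funK f) (sym_funK g))
        (can_comp (sym_invK g) (sym_invK f)).

Definition sym_V (f : Sym T) : Sym T := MkSym (sym_invK f) (sym_funK f).

Fact sym_mulA : associative sym_mul.
Proof. by move=> f g h; apply: sym_eq. Qed.
Fact sym_mul1 : left_id sym_one sym_mul.
Proof. by move=> f; apply: sym_eq. Qed.
Fact sym_mulr1 : right_id sym_one sym_mul.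
Proof. by move=> f; apply: sym_eq. Qed.
Fact sym_mulV : left_inverse sym_one sym_V sym_mul.
Proof. by move=> f; apply: sym_eq => x; apply: sym_funK. Qed.
Fact sym_mulrV : right_inverse sym_one sym_V sym_mul.
Proof. by move=> f; apply: sym_eq => x; apply: sym_invK. Qed.

HB.instance Definition _ :=
  isGroup.Build (Sym T) sym_mulA sym_mul1 sym_mulr1 sym_mulV sym_mulrV.

End SymGroup.

Definition is_subgroup (G : groupType) (H : set G) : Prop :=
  [/\ H 1, (forall x y, H x -> H y -> H (x * y)) & forall x, H x -> H x^-1].

Definition generated (G : groupType) (A : set G) : set G :=
  smallest (@is_subgroup G) A.

Definition commutator_subgroup (G : groupType) (H K : set G) : set G :=
  generated [set [~ x, y] | x in H & y in K].

Section GroupFacts.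
Variable G : groupType.
Implicit Types (A H K : set G).

Lemma generated_subgroup A : is_subgroup (generated A).
Proof.
split=> [H [[]] //|x y Hx Hy H|x Hx H] HA; case: (HA) => -[H1 HM HV] _.
  by apply: HM; [apply: Hx|apply: Hy].
by apply: HV; apply: Hx.
Qed.

Lemma sub_generated A : A `<=` generated A.
Proof. exact: sub_gen_smallest. Qed.

Lemma generated_sub A H : is_subgroup H -> A `<=` H -> generated A `<=` H.
Proof. exact: smallest_sub. Qed.

Lemma generated_conj A (h : G) :
    (forall x, A x -> generated A (h * x * h^-1)) ->
  forall x, generated A x -> generated A (h * x * h^-1).
Proof.
move=> hA; apply: (@generated_sub A [set x | generated A (h * x * h^-1)]) => //.
have [g1 gM gV] := generated_subgroup A; split=> /=.
- by rewrite mulg1 mulgV.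
- move=> x y hx hy; have := gM _ _ hx hy.
  by rewrite !mulgA mulgVK.
- by move=> x /gV; rewrite !invgM invgK mulgA.
Qed.

End GroupFacts.

Section LeftQuasigroups.
Variable Q : leftQuasigroupType.

Definition Lmul (a : Q) : Sym Q := MkSym (@qmulK Q a) (@qldivK Q a).

Definition LMlt : set (Sym Q) := generated (range Lmul).

Definition connected : Prop := forall a b : Q, exists2 h, LMlt h & h a = b.

Record subalgebra := MkSubalgebra {
  subalg_set :> set Q;
  subalg_mul : forall x y, subalg_set x -> subalg_set y -> subalg_set (x *q y);
  subalg_ldiv : forall x y, subalg_set x -> subalg_set y -> subalg_set (x \q y)
}.

Record congruence := MkCongruence {
  con_rel :> Q -> Q -> Prop;
  con_refl : forall x, con_rel x x;
  con_sym : forall x y, con_rel x y -> con_rel y x;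
  con_trans : forall x y z, con_rel x y -> con_rel y z -> con_rel x z;
  con_mul : forall a b c d,
    con_rel a b -> con_rel c d -> con_rel (a *q c) (b *q d);
  con_ldiv : forall a b c d,
    con_rel a b -> con_rel c d -> con_rel (a \q c) (b \q d)
}.

Lemma con_eq (alpha beta : congruence) :
  (forall x y, alpha x y <-> beta x y) -> alpha = beta.
Proof.
case: alpha => r r1 r2 r3 r4 r5; case: beta => s s1 s2 s3 s4 s5 /= rs.
have E : r = s by apply/funext => x; apply/funext => y; apply/propext.
by subst s; congr MkCongruence; exact: Prop_irrelevance.
Qed.

Definition con_full : congruence :=
  @MkCongruence (fun _ _ => True) (fun _ => I) (fun _ _ _ => I)
    (fun _ _ _ _ _ => I) (fun _ _ _ _ _ _ => I) (fun _ _ _ _ _ _ => I).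

End LeftQuasigroups.

Definition subalg_type (Q : leftQuasigroupType) (S : subalgebra Q) : Type :=
  {x : Q | subalg_set S x}.

Section SubLeftQuasigroup.
Variables (Q : leftQuasigroupType) (S : subalgebra Q).

Definition subalg_qmul (x y : subalg_type S) : subalg_type S :=
  exist (subalg_set S) _ (subalg_mul (proj2_sig x) (proj2_sig y)).

Definition subalg_qldiv (x y : subalg_type S) : subalg_type S :=
  exist (subalg_set S) _ (subalg_ldiv (proj2_sig x) (proj2_sig y)).

Fact subalg_qmulK x y : subalg_qldiv x (subalg_qmul x y) = y.
Proof. by case: x y => [x Sx] [y Sy]; apply: eq_exist; apply: qmulK. Qed.

Fact subalg_qldivK x y : subalg_qmul x (subalg_qldiv x y) = y.
Proof. by case: x y => [x Sx] [y Sy]; apply: eq_exist; apply: qldivK. Qed.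

HB.instance Definition _ :=
  isLeftQuasigroup.Build (subalg_type S) subalg_qmulK subalg_qldivK.

End SubLeftQuasigroup.

Definition superconnected (Q : leftQuasigroupType) : Prop :=
  forall S : subalgebra Q, connected (subalg_type S).

Inductive term (V : Type) : Type :=
  | Var of V
  | Mul of term V & term V
  | Ldiv of term V & term V.

Fixpoint eval (Q : leftQuasigroupType) (V : Type) (e : V -> Q) (t : term V) :
    Q :=
  match t with
  | Var v => e v
  | Mul t1 t2 => eval e t1 *q eval e t2
  | Ldiv t1 t2 => eval e t1 \q eval e t2
  end.

(* [t(a, u_1, ..., u_n)]: the variable [None] stands for [x], and [Some i] for
   [y_(i+1)]. *)
Definition teval (Q : leftQuasigroupType) (n : nat) (t : term (option 'I_n))
    (a : Q) (u : 'I_n -> Q) : Q :=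
  eval (fun v => if v is Some i then u i else a) t.

Section Commutator.
Variable Q : leftQuasigroupType.
Implicit Types alpha beta delta : congruence Q.

Definition centralizes alpha beta delta : Prop :=
  forall (n : nat) (t : term (option 'I_n)) (a b : Q) (u v : 'I_n -> Q),
    alpha a b -> (forall i, beta (u i) (v i)) ->
    delta (teval t a u) (teval t a v) -> delta (teval t b u) (teval t b v).

Definition con_commutator_rel alpha beta (x y : Q) : Prop :=
  forall delta, centralizes alpha beta delta -> delta x y.

Definition con_commutator alpha beta : congruence Q.
Proof.
apply: (@MkCongruence Q (con_commutator_rel alpha beta)).
- by move=> x delta _; apply: con_refl.
- by move=> x y xy delta /xy; apply: con_sym.
- move=> x y z xy yz delta C.
  by apply: (@con_trans _ _ _ y); [apply: xy|apply: yz].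
- by move=> a b c d ab cd delta C; apply: con_mul; [apply: ab|apply: cd].
- by move=> a b c d ab cd delta C; apply: con_ldiv; [apply: ab|apply: cd].
Defined.

Lemma con_commutator_centralizes alpha beta :
  centralizes alpha beta (con_commutator alpha beta).
Proof. by move=> n t a b u v ab uv H delta C; apply: C ab uv (H _ C). Qed.

Lemma con_commutator_least alpha beta delta :
  centralizes alpha beta delta ->
  forall x y, con_commutator alpha beta x y -> delta x y.
Proof. by move=> C x y; apply. Qed.

Definition Dis_gen alpha : set (Sym Q) :=
  [set g | exists h a b,
     [/\ LMlt h, alpha a b & g = h * Lmul a * (Lmul b)^-1 * h^-1]].

Definition Dis_set alpha : set (Sym Q) := generated (Dis_gen alpha).

Record normal_subgroup := MkNormalSubgroup {
  norm_set :> set (Sym Q);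
  norm_subgroup : is_subgroup norm_set;
  norm_conj : forall h g, LMlt h -> norm_set g -> norm_set (h * g * h^-1);
  norm_sub_Dis : norm_set `<=` Dis_set (con_full Q)
}.

Lemma norm_eq (M N : normal_subgroup) :
  (norm_set M `<=>` norm_set N) -> M = N.
Proof.
case: M => r r1 r2 r3; case: N => s s1 s2 s3 /= rs.
have E : r = s by apply/seteqP.
by subst s; congr MkNormalSubgroup; exact: Prop_irrelevance.
Qed.

Lemma Dis_conj alpha h g :
  LMlt h -> Dis_set alpha g -> Dis_set alpha (h * g * h^-1).
Proof.
move=> Lh; apply: generated_conj => _ [k [a [b [Lk ab ->]]]].
apply: sub_generated; exists (h * k), a, b; split=> //.
  by have [_ LM _] := generated_subgroup (range (@Lmul Q)); apply: LM.
by rewrite invgM !mulgA.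
Qed.

Lemma Dis_sub_full alpha : Dis_set alpha `<=` Dis_set (con_full Q).
Proof.
apply: generated_sub; first exact: generated_subgroup.
move=> _ [h [a [b [Lh _ ->]]]]; apply: sub_generated.
by exists h, a, b.
Qed.

Definition Dis alpha : normal_subgroup :=
  MkNormalSubgroup (generated_subgroup _) (@Dis_conj alpha)
    (@Dis_sub_full alpha).

Section NormCommutator.
Variables M N : normal_subgroup.

Lemma norm_commutator_conj h g :
  LMlt h -> commutator_subgroup M N g -> commutator_subgroup M N (h * g * h^-1).
Proof.
move=> Lh; apply: generated_conj => _ [x Mx [y Ny <-]].
apply: sub_generated; exists (h * x * h^-1); first exact: norm_conj.
exists (h * y * h^-1); first exact: norm_conj.
by rewrite /commg /conjg !invgM !invgK !mulgA !mulgVK.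
Qed.

Lemma norm_commutator_sub :
  commutator_subgroup M N `<=` Dis_set (con_full Q).
Proof.
have [_ DM DV] := generated_subgroup (Dis_gen (con_full Q)).
apply: generated_sub; first exact: generated_subgroup.
move=> _ [x /norm_sub_Dis Dx [y /norm_sub_Dis Dy <-]].
by exact: (DM _ _ (DV _ Dx) (DM _ _ (DV _ Dy) (DM _ _ Dx Dy))).
Qed.

Definition norm_commutator : normal_subgroup :=
  MkNormalSubgroup (generated_subgroup _) norm_commutator_conj
    norm_commutator_sub.

End NormCommutator.

End Commutator.

Section QuandleCon.
Variable Q : quandleType.

Lemma Lmul_qmul (a b : Q) : Lmul (a *q b) = Lmul a * Lmul b * (Lmul a)^-1.
Proof.
apply: sym_eq => x; change ((a *q b) *q x = a *q (b *q (a \q x))).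
by rewrite qmul_distr qldivK.
Qed.

Lemma Lmul_qldiv (a b : Q) : Lmul (a \q b) = (Lmul a)^-1 * Lmul b * Lmul a.
Proof.
by rewrite -{2}(qldivK a b) Lmul_qmul !mulgA mulgVK mulVg mul1g.
Qed.

Lemma LMlt_Lmul (a : Q) : LMlt (Lmul a).
Proof. by apply: sub_generated; exists a. Qed.

Lemma LMlt_LmulV (a : Q) : LMlt (Lmul a)^-1.
Proof.
have [_ _ LV] := generated_subgroup (range (@Lmul Q)).
exact: LV (LMlt_Lmul a).
Qed.

Section ConNorm.
Variable N : normal_subgroup Q.

Definition con_norm_rel (a b : Q) : Prop := norm_set N (Lmul a * (Lmul b)^-1).

Fact con_norm_refl x : con_norm_rel x x.
Proof. by rewrite /con_norm_rel mulgV; case: (norm_subgroup N). Qed.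

Fact con_norm_sym x y : con_norm_rel x y -> con_norm_rel y x.
Proof.
have [_ _ NV] := norm_subgroup N.
by move=> /NV; rewrite invgM invgK.
Qed.

Fact con_norm_trans x y z :
  con_norm_rel x y -> con_norm_rel y z -> con_norm_rel x z.
Proof.
have [_ NM _] := norm_subgroup N.
by move=> xy yz; have := NM _ _ xy yz; rewrite mulgA mulgVK.
Qed.

Fact con_norm_mul a b c d :
  con_norm_rel a b -> con_norm_rel c d -> con_norm_rel (a *q c) (b *q d).
Proof.
have [_ NM NV] := norm_subgroup N.
move=> ab cd; rewrite /con_norm_rel !Lmul_qmul.
have H1 := norm_conj (LMlt_Lmul a) cd.
have H2 := norm_conj (LMlt_Lmul a) (norm_conj (LMlt_Lmul d)
  (norm_conj (LMlt_LmulV a) (NV _ ab))).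
have := NM _ _ (NM _ _ H1 H2) ab.
by rewrite !invgM !invgK !mulgA !(mulgVK, mulgK).
Qed.

Fact con_norm_ldiv a b c d :
  con_norm_rel a b -> con_norm_rel c d -> con_norm_rel (a \q c) (b \q d).
Proof.
have [_ NM NV] := norm_subgroup N.
move=> ab cd; rewrite /con_norm_rel !Lmul_qldiv.
have H1 := norm_conj (LMlt_LmulV a) cd.
have H2 := norm_conj (LMlt_LmulV a) (NM _ _ (norm_conj (LMlt_Lmul d) ab)
  (NV _ ab)).
have := NM _ _ H1 H2.
by rewrite !invgM !invgK !mulgA !(mulgVK, mulgK).
Qed.

Definition con : congruence Q :=
  MkCongruence con_norm_refl con_norm_sym con_norm_trans con_norm_mul
    con_norm_ldiv.

End ConNorm.

End QuandleCon.

(* Main.v *)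
Require Import Defs.
From mathcomp Require Import all_boot.
From mathcomp Require Import boolp classical_sets.

(** The proof rests on one consequence of superconnectedness and on one fact
    about groups.

    Every quotient of a superconnected quandle is faithful: if [a * x] and
    [b * x] are always congruent modulo [delta], then the union of the classes
    of [a] and [b] is a subalgebra on which every left translation acts
    trivially modulo [delta], so connectedness of that subalgebra puts [a] and
    [b] in the same class ([superconnected_faithful]).  Hence, as soon as a
    normal subgroup [N] acts trivially on [Q / delta], the congruence [con N]
    lies below [delta] ([con_sub]).  Since [Dis alpha] acts trivially on
    [Q / alpha], this gives [alpha = con (Dis alpha)], from which injectivity
    and surjectivity in the second part are formal.

    For the commutator, write [N] for the group commutator of [Dis alpha] and
    [Dis beta].

    - [con N] satisfies the term condition, in any quandle.  Since
      [L_(a * b) = L_a L_b L_a^-1], the map [L] turns the two by two matrices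
      of the term condition into matrices of group elements generated by those
      with constant rows and entries congruent modulo [Dis alpha], and those
      with constant columns and entries congruent modulo [Dis beta].  Modulo
      [N] these two subgroups commute, and then the quotient of the two
      entries of a row is the same for both rows; so it lies in [N] for one row
      iff it does for the other.

    - If [delta] satisfies the term condition, then [N] acts trivially on
      [Q / delta], so [con N] lies below [delta] by faithfulness.  For
      generators [g = h L_a L_b^-1 h^-1] of [Dis alpha] and
      [f = k L_u L_v^-1 k^-1] of [Dis beta], the commutator
      [g^-1 f g f^-1] applied to a point [x] is a term in [a] and [u] whose
      value becomes [x] when [a] is replaced by [b] or [u] by [v]; the term
      condition does the rest. *)

Set Implicit Arguments.
Unset Strict Implicit.
Unset Printing Implicit Defensive.
Local Open Scope classical_set_scope.
Local Open Scope group_scope.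
Local Open Scope quandle_scope.

(** * Permutations acting trivially modulo a relation *)

Section ActionModulo.
Variables (T : Type) (R : T -> T -> Prop).
Hypotheses (Rrefl : forall x, R x x) (Rsym : forall x y, R x y -> R y x)
  (Rtrans : forall x y z, R x y -> R y z -> R x z).

Definition acts_trivially (k : Sym T) : Prop := forall x, R (k x) x.

Lemma acts_trivially_subgroup : is_subgroup acts_trivially.
Proof.
split=> [x|f g Hf Hg x|f Hf x]; first exact: Rrefl.
  exact: Rtrans (Hf (g x)) (Hg x).
by apply: Rsym; rewrite -{1}(sym_invK f x); apply: Hf.
Qed.

End ActionModulo.

Section LeftMultiplicationGroup.
Variable Q : quandleType.
Implicit Types (alpha beta delta : congruence Q) (M N : normal_subgroup Q).
Implicit Types (f g h k r s : Sym Q).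

Lemma LMlt_subgroup : is_subgroup (@LMlt Q).
Proof. exact: generated_subgroup. Qed.

Lemma LMltM g h : LMlt g -> LMlt h -> LMlt (g * h).
Proof. by case: LMlt_subgroup => _ LM _; apply: LM. Qed.

Lemma LMltV h : LMlt h -> LMlt h^-1.
Proof. by case: LMlt_subgroup => _ _ LV; apply: LV. Qed.

Lemma norm_conjg N g h : LMlt h -> norm_set N g -> norm_set N (g ^ h).
Proof.
by move=> /LMltV Lh /(norm_conj Lh); rewrite invgK /conjg mulgA.
Qed.

Lemma LMlt_con alpha h x y : LMlt h -> alpha x y -> alpha (h x) (h y).
Proof.
move=> Lh.
pose P := [set h : Sym Q |
  forall x y, alpha x y -> alpha (h x) (h y) /\ alpha (h^-1 x) (h^-1 y)].
suff /(_ h Lh) : @LMlt Q `<=` P by move=> Ph /Ph[].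
apply: generated_sub => [|_ [a _ <-] u v uv]; last first.
  by split; [apply: con_mul|apply: con_ldiv] => //; apply: con_refl.
split=> [u v|g k Hg Hk u v uv|g Hg u v uv] //.
  split; first by apply: (Hg _ _ _).1; apply: (Hk _ _ uv).1.
  by apply: (Hk _ _ _).2; apply: (Hg _ _ uv).2.
by rewrite invgK; have [] := Hg _ _ uv; split.
Qed.

Lemma Dis_gen_LMlt alpha : Dis_gen alpha `<=` @LMlt Q.
Proof.
move=> _ [h [a [b [Lh _ ->]]]].
by do ![apply: LMltM|apply: LMltV] => //; apply: LMlt_Lmul.
Qed.

Lemma norm_LMlt N : N `<=` @LMlt Q.
Proof.
move=> g /norm_sub_Dis; apply: (generated_sub LMlt_subgroup).
exact: Dis_gen_LMlt.
Qed.

Lemma Dis_acts_trivially alpha : Dis alpha `<=` acts_trivially alpha.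
Proof.
apply: generated_sub.
  exact: (acts_trivially_subgroup (@con_refl _ alpha) (@con_sym _ alpha)
           (@con_trans _ alpha)).
move=> _ [h [a [b [Lh ab ->]]]] x.
change (alpha (h (a *q (b \q sym_inv h x))) x).
rewrite -[X in alpha _ X](sym_invK h); apply: LMlt_con => //.
rewrite -[X in alpha _ X](qldivK b).
by apply: con_mul => //; apply: con_refl.
Qed.

Lemma Dis_Lmul alpha a b : alpha a b -> norm_set (Dis alpha) (Lmul a * (Lmul b)^-1).
Proof.
move=> ab; apply: sub_generated; exists 1, a, b; split=> //.
  by case: LMlt_subgroup.
by rewrite mul1g invg1 mulg1.
Qed.

(** * Faithfulness of the quotients of a superconnected quandle *)

Section Faithful.
Variables (delta : congruence Q) (a b : Q).
Hypothesis ab_mul : forall x, delta (a *q x) (b *q x).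

Let classes : set Q := [set x | delta x a \/ delta x b].

(** Modulo [delta] the two classes form a projection quandle, because
    [a * b] is congruent to [b * b = b] and [b * a] to [a * a = a]. *)
Lemma classes_mul x y : classes x -> classes y -> delta (x *q y) y.
Proof.
have mulE c d : delta c a \/ delta c b -> d = a \/ d = b -> delta (c *q d) d.
  move=> Hc Hd.
  have [ca cb] : delta (c *q d) (a *q d) /\ delta (c *q d) (b *q d).
    have dd := con_refl delta d.
    case: Hc => /con_mul /(_ dd) Hc; split=> //.
      exact: con_trans Hc (ab_mul d).
    exact: con_trans Hc (con_sym (ab_mul d)).
  by case: Hd => Hd; subst d; rewrite qmul_idem in ca cb.
move=> Hx Hy.
have [c Hc yc] : exists2 c, c = a \/ c = b & delta y c.
  by case: Hy; [exists a|exists b] => //; [left|right].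
have xyxc := con_mul (con_refl delta x) yc.
exact: con_trans xyxc (con_trans (mulE _ _ Hx Hc) (con_sym yc)).
Qed.

Lemma classes_ldiv x y : classes x -> classes y -> delta (x \q y) y.
Proof.
move=> Hx Hy; apply: con_sym; rewrite -{1}(qmulK x y).
by apply: con_ldiv; [apply: con_refl|apply: classes_mul].
Qed.

Lemma classes_closed x y : classes y -> delta x y -> classes x.
Proof.
by case=> Hy xy; [left|right]; apply: con_trans xy Hy.
Qed.

Definition two_classes : subalgebra Q :=
  @MkSubalgebra _ classes
    (fun x y Hx Hy => classes_closed Hy (classes_mul Hx Hy))
    (fun x y Hx Hy => classes_closed Hy (classes_ldiv Hx Hy)).

Lemma superconnected_faithful : superconnected Q -> delta a b.
Proof.
move=> /(_ two_classes) conn.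
pose a' : subalg_type two_classes := exist _ a (or_introl (con_refl delta a)).
pose b' : subalg_type two_classes := exist _ b (or_intror (con_refl delta b)).
have [h Lh hab] := conn a' b'.
pose R (x y : subalg_type two_classes) := delta (proj1_sig x) (proj1_sig y).
suff /(_ h Lh) /(_ a') : @LMlt (subalg_type two_classes) `<=` acts_trivially R.
  by rewrite hab; apply: con_sym.
apply: generated_sub => [|_ [c _ <-] x].
  apply: acts_trivially_subgroup => [x|x y|x y z]; rewrite /R.
  - exact: con_refl.
  - exact: con_sym.
  - exact: con_trans.
exact: classes_mul (proj2_sig c) (proj2_sig x).
Qed.

End Faithful.

Lemma con_sub N delta a b : superconnected Q ->
  N `<=` acts_trivially delta -> con N a b -> delta a b.
Proof.
move=> HQ HN /HN ab; apply: superconnected_faithful HQ => x.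
by move: (ab (b *q x)) => /=; rewrite qmulK.
Qed.

Lemma con_Dis alpha : superconnected Q -> con (Dis alpha) = alpha.
Proof.
move=> HQ; apply: con_eq => a b; split; last exact: Dis_Lmul.
exact: con_sub HQ (@Dis_acts_trivially alpha).
Qed.

(** * Matrices of the term condition *)

Section TermMatrix.
Variables (beta : congruence Q) (a b : Q).

(** The quadruples [t(a,u), t(a,v), t(b,u), t(b,v)] of the term condition,
    presented as a subalgebra of the fourth power of [Q] given by generators:
    in this form they can be built from words in the left multiplication
    group, and reasoned about by induction, without handling terms. *)
Inductive term_matrix : Q -> Q -> Q -> Q -> Prop :=
  | tm_row : term_matrix a a b b
  | tm_col u v of beta u v : term_matrix u v u v
  | tm_mul w x y z w' x' y' z' of
      term_matrix w x y z & term_matrix w' x' y' z' :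
      term_matrix (w *q w') (x *q x') (y *q y') (z *q z')
  | tm_ldiv w x y z w' x' y' z' of
      term_matrix w x y z & term_matrix w' x' y' z' :
      term_matrix (w \q w') (x \q x') (y \q y') (z \q z').

Lemma term_matrix_teval n (t : term (option 'I_n)) (u v : 'I_n -> Q) :
    (forall i, beta (u i) (v i)) ->
  term_matrix (teval t a u) (teval t a v) (teval t b u) (teval t b v).
Proof.
move=> uv; rewrite /teval; elim: t => [[i|]|t1 H1 t2 H2|t1 H1 t2 H2] /=.
- exact: tm_col.
- exact: tm_row.
- exact: tm_mul.
- exact: tm_ldiv.
Qed.

Lemma term_matrix_LMlt h w x y z : LMlt h ->
  term_matrix w x y z -> term_matrix (h w) (h x) (h y) (h z).
Proof.
move=> Lh.
pose P := [set h : Sym Q | forall w x y z, term_matrix w x y z ->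
  term_matrix (h w) (h x) (h y) (h z) /\
  term_matrix (h^-1 w) (h^-1 x) (h^-1 y) (h^-1 z)].
suff /(_ h Lh) : @LMlt Q `<=` P by move=> Ph /Ph[].
apply: generated_sub => [|_ [c _ <-] {}w {}x {}y {}z m]; last first.
  have cc := tm_col (con_refl beta c).
  by split; [apply: tm_mul|apply: tm_ldiv].
split=> [? ? ? ?|f g Hf Hg ? ? ? ? m|f Hf ? ? ? ? m] //.
  split; first by apply: (Hf _ _ _ _ _).1; apply: (Hg _ _ _ _ m).1.
  by apply: (Hg _ _ _ _ _).2; apply: (Hf _ _ _ _ m).2.
by rewrite invgK; have [] := Hf _ _ _ _ m; split.
Qed.

End TermMatrix.

Fixpoint rename (V W : Type) (s : V -> W) (t : term V) : term W :=
  match t with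
  | Var v => Var (s v)
  | Mul t1 t2 => Mul (rename s t1) (rename s t2)
  | Ldiv t1 t2 => Ldiv (rename s t1) (rename s t2)
  end.

Lemma eval_rename (V W : Type) (s : V -> W) (e : W -> Q) (d : V -> Q) t :
  (forall v, e (s v) = d v) -> eval e (rename s t) = eval d t.
Proof. by move=> ed; elim: t => //= t1 -> t2 ->. Qed.

Definition join_args n1 n2 (u1 : 'I_n1 -> Q) (u2 : 'I_n2 -> Q)
  (i : 'I_(n1 + n2)) : Q :=
  match split i with inl j => u1 j | inr j => u2 j end.

Lemma teval_lshift n1 n2 (t : term (option 'I_n1)) a u1 (u2 : 'I_n2 -> Q) :
  teval (rename (omap (@lshift n1 n2)) t) a (join_args u1 u2) = teval t a u1.
Proof.
by apply: eval_rename => -[i|] //=; rewrite /join_args (unsplitK (inl i)).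
Qed.

Lemma teval_rshift n1 n2 (t : term (option 'I_n2)) a (u1 : 'I_n1 -> Q) u2 :
  teval (rename (omap (@rshift n1 n2)) t) a (join_args u1 u2) = teval t a u2.
Proof.
by apply: eval_rename => -[i|] //=; rewrite /join_args (unsplitK (inr i)).
Qed.

Section Realisation.
Variables (beta : congruence Q) (a b : Q).

Definition realised (w x y z : Q) : Prop :=
  exists n (t : term (option 'I_n)) (u v : 'I_n -> Q),
    (forall i, beta (u i) (v i)) /\
    [/\ w = teval t a u, x = teval t a v, y = teval t b u & z = teval t b v].

(** Two terms are put over a common list of variables by concatenating their
    arguments. *)
Lemma realised_pair w x y z w' x' y' z' :
    realised w x y z -> realised w' x' y' z' ->
  exists n (t t' : term (option 'I_n)) (u v : 'I_n -> Q),
    [/\ forall i, beta (u i) (v i),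
        [/\ w = teval t a u, x = teval t a v,
            y = teval t b u & z = teval t b v]
      & [/\ w' = teval t' a u, x' = teval t' a v,
            y' = teval t' b u & z' = teval t' b v]].
Proof.
move=> [n1 [t1 [u1 [v1 [uv1 E1]]]]] [n2 [t2 [u2 [v2 [uv2 E2]]]]].
exists (n1 + n2)%N, (rename (omap (@lshift n1 n2)) t1),
  (rename (omap (@rshift n1 n2)) t2), (join_args u1 u2), (join_args v1 v2).
split; [|by rewrite !teval_lshift|by rewrite !teval_rshift].
by move=> i; rewrite /join_args; case: (split i).
Qed.

Lemma term_matrix_realised w x y z :
  term_matrix beta a b w x y z -> realised w x y z.
Proof.
elim=> {w x y z} [|u v uv|? ? ? ? ? ? ? ? _ H1 _ H2|? ? ? ? ? ? ? ? _ H1 _ H2].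
- by exists 0%N, (Var None), (fun=> a), (fun=> a); split=> // i; apply: con_refl.
- by exists 1%N, (Var (Some ord0)), (fun=> u), (fun=> v).
- have [n [t [t' [u [v [uv [-> -> -> ->] [-> -> -> ->]]]]]]] :=
    realised_pair H1 H2.
  by exists n, (Mul t t'), u, v.
- have [n [t [t' [u [v [uv [-> -> -> ->] [-> -> -> ->]]]]]]] :=
    realised_pair H1 H2.
  by exists n, (Ldiv t t'), u, v.
Qed.

End Realisation.

Lemma centralizesP alpha beta delta :
  centralizes alpha beta delta <->
  (forall a b, alpha a b -> forall w x y z,
     term_matrix beta a b w x y z -> delta w x -> delta y z).
Proof.
split=> [C a b ab w x y z|C n t a b u v ab uv].
  move=> /term_matrix_realised [n [t [u [v [uv [-> -> -> ->]]]]]].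
  exact: C.
by apply: C (term_matrix_teval _ _ _ uv).
Qed.

(** * The term condition for the congruence of a commutator subgroup *)

Section CommutatorCentralizes.
Variables A B : normal_subgroup Q.

Local Notation N := (norm_commutator A B).

Definition eqmod g h : Prop := norm_set N (g * h^-1).

Lemma eqmod_refl g : eqmod g g.
Proof. by rewrite /eqmod mulgV; case: (norm_subgroup N). Qed.

Lemma eqmod_trans g h k : eqmod g h -> eqmod h k -> eqmod g k.
Proof.
have [_ NM _] := norm_subgroup N.
by move=> gh hk; have := NM _ _ gh hk; rewrite mulgA mulgVK.
Qed.

Lemma eqmodV g h : LMlt g -> eqmod g h -> eqmod g^-1 h^-1.
Proof.
have [_ _ NV] := norm_subgroup N.
move=> Lg /NV /(norm_conjg Lg).
by rewrite /eqmod /conjg !invgM !invgK !mulgA mulgVK.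
Qed.

Lemma eqmodM g h g' h' :
  LMlt g -> eqmod g h -> eqmod g' h' -> eqmod (g * g') (h * h').
Proof.
have [_ NM _] := norm_subgroup N.
move=> Lg gh /(norm_conj Lg) gh'; have := NM _ _ gh' gh.
by rewrite /eqmod invgM !mulgA mulgVK.
Qed.

Lemma eqmodJ g h k : LMlt k -> eqmod g h -> eqmod (g ^ k) (h ^ k).
Proof. by move=> Lk /(norm_conjg Lk); rewrite conjMg conjVg. Qed.

Lemma eqmod_comm r s : norm_set A s -> norm_set B r -> eqmod (r ^ s) r.
Proof.
have [_ _ AV] := norm_subgroup A; have [_ _ NV] := norm_subgroup N.
move=> As Br; have Nsr : norm_set N [~ s, r^-1].
  apply: sub_generated; exists s => //; exists r^-1 => //.
  by have [_ _ BV] := norm_subgroup B; apply: BV.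
by rewrite /eqmod; move: Nsr; rewrite /commg /conjg invgK !mulgA.
Qed.

(** The last component is the one of interest: modulo the commutator, both
    rows have the same quotient.  The other components make the property
    stable under products, where quotients get conjugated by [w] in the first
    row and by [y] in the second. *)
Definition equal_row_quotients (w x y z : Sym Q) : Prop :=
  [/\ LMlt w, norm_set A (w^-1 * y), norm_set B (w * x^-1)
    & eqmod (w * x^-1) (y * z^-1)].

Lemma row_quotients_mul w x y z w' x' y' z' :
  equal_row_quotients w x y z -> equal_row_quotients w' x' y' z' ->
  equal_row_quotients (w * w') (x * x') (y * y') (z * z').
Proof.
move=> [Lw Ay Bx E] [Lw' Ay' Bx' E'].
have [_ AM AV] := norm_subgroup A; have [_ BM _] := norm_subgroup B.
(* If [y = w s], conjugation by [y] differs from conjugation by [w] by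
   [s], which centralizes [B] modulo the commutator. *)
have conj_wy : eqmod ((w' * x'^-1) ^ w^-1) ((y' * z'^-1) ^ y^-1).
  have Ly : LMlt y.
    by rewrite -(mulVKg w y); apply: LMltM => //; apply: norm_LMlt Ay.
  apply: eqmod_trans (eqmodJ (LMltV Ly) E').
  have -> : y^-1 = (w^-1 * y)^-1 * w^-1 by rewrite invgM invgK mulgK.
  rewrite conjgM; apply: eqmodJ; first exact: LMltV.
  have [_ _ NV] := norm_subgroup N.
  by have := NV _ (eqmod_comm (AV _ Ay) Bx'); rewrite invgM invgK.
have split_row g g' k k' :
    g * g' * (k * k')^-1 = (g' * k'^-1) ^ g^-1 * (g * k^-1).
  by rewrite /conjg invgK invgM !mulgA mulgVK.
split; first exact: LMltM.
- have := AM _ _ (norm_conjg Lw' Ay) Ay'.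
  by rewrite /conjg invgM !mulgA mulgK.
- rewrite split_row; apply: BM => //.
  by apply: norm_conjg => //; apply: LMltV.
- rewrite !split_row; apply: eqmodM => //.
  by apply: (@norm_LMlt B); apply: norm_conjg => //; apply: LMltV.
Qed.

Lemma row_quotients_inv w x y z :
  equal_row_quotients w x y z -> equal_row_quotients w^-1 x^-1 y^-1 z^-1.
Proof.
move=> [Lw Ay Bx E].
have [_ AM AV] := norm_subgroup A; have [_ BM BV] := norm_subgroup B.
have LwV := LMltV Lw.
have Ly : LMlt y.
  by rewrite -(mulVKg w y); apply: LMltM => //; apply: norm_LMlt Ay.
have inv_row (g k : Sym Q) : g^-1 * k^-1^-1 = (g * k^-1)^-1 ^ g.
  by rewrite /conjg invgM !invgK !mulgA mulgVK.
split=> //.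
- by have := norm_conjg LwV (AV _ Ay); rewrite /conjg invgM !invgK !mulgA mulgK.
- by rewrite inv_row; apply: norm_conjg => //; apply: BV.
- rewrite !inv_row.
  apply: eqmod_trans (eqmodJ Ly (eqmodV (norm_LMlt Bx) E)).
  have -> : y = (y * w^-1) * w by rewrite mulgVK.
  rewrite conjgM; apply: eqmodJ => //.
  have Ayw : norm_set A (y * w^-1).
    by have := norm_conj Lw Ay; rewrite mulgA mulgV mul1g.
  have [_ _ NV] := norm_subgroup N.
  by have := NV _ (eqmod_comm Ayw (BV _ Bx)); rewrite invgM !invgK.
Qed.

End CommutatorCentralizes.

Lemma term_matrix_row_quotients alpha beta a b w x y z : alpha a b ->
    term_matrix beta a b w x y z ->
  equal_row_quotients (Dis alpha) (Dis beta)
    (Lmul w) (Lmul x) (Lmul y) (Lmul z).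
Proof.
move=> ab; have [A1 _ AV] := norm_subgroup (Dis alpha).
have [B1 _ _] := norm_subgroup (Dis beta).
elim=> {w x y z}.
- split; first exact: LMlt_Lmul.
  + have := norm_conjg (LMlt_Lmul a) (AV _ (Dis_Lmul ab)).
    by rewrite /conjg invgM invgK !mulgA mulgVK.
  + by rewrite mulgV.
  + by rewrite !mulgV; apply: eqmod_refl.
- move=> u v uv; split; first exact: LMlt_Lmul.
  + by rewrite mulVg.
  + exact: Dis_Lmul.
  + exact: eqmod_refl.
- move=> w x y z w' x' y' z' _ E _ E'; rewrite !Lmul_qmul.
  by do ![apply: row_quotients_mul|apply: row_quotients_inv] => //.
- move=> w x y z w' x' y' z' _ E _ E'; rewrite !Lmul_qldiv.
  by do ![apply: row_quotients_mul|apply: row_quotients_inv] => //.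
Qed.

Lemma con_norm_commutator_centralizes alpha beta :
  centralizes alpha beta (con (norm_commutator (Dis alpha) (Dis beta))).
Proof.
apply/centralizesP => a b ab w x y z m wx.
have [_ _ _ E] := term_matrix_row_quotients ab m.
have [_ NM NV] := norm_subgroup (norm_commutator (Dis alpha) (Dis beta)).
have := NM _ _ (NV _ E) wx.
by rewrite invgM invgK mulgVK.
Qed.

(** * The action of the commutator subgroup modulo a centralizing congruence *)

Definition commute_mod delta f g : Prop := forall x, delta (f (g x)) (g (f x)).

Lemma commute_mod_sym delta f g : commute_mod delta f g -> commute_mod delta g f.
Proof. by move=> fg x; apply: con_sym. Qed.

Lemma commute_mod_generated delta f (X : set (Sym Q)) : LMlt f ->
    X `<=` @LMlt Q -> (forall g, X g -> commute_mod delta f g) ->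
  forall g, generated X g -> commute_mod delta f g.
Proof.
move=> Lf XL fX g Xg.
pose P := [set g : Sym Q | LMlt g /\ commute_mod delta f g].
suff /(_ g Xg) : generated X `<=` P by case.
apply: generated_sub => [|h Xh]; last by split; [apply: XL|apply: fX].
split=> [|h k [Lh fh] [Lk fk]|h [Lh fh]].
- by split=> [|x]; [case: LMlt_subgroup|apply: con_refl].
- split=> [|x]; first exact: LMltM.
  exact: con_trans (fh (k x)) (LMlt_con Lh (fk x)).
- split=> [|x]; first exact: LMltV.
  have := LMlt_con (LMltV Lh) (fh (h^-1 x)).
  rewrite [_ (h (f _))]sym_funK [h (h^-1 x)]sym_invK => H.
  exact: con_sym.
Qed.

(** This is where the term condition enters: for generators, only one point
    has to move along [alpha] and one along [beta]. *)
Lemma centralizes_commute_gen alpha beta delta f g :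
    centralizes alpha beta delta ->
  Dis_gen alpha g -> Dis_gen beta f -> commute_mod delta f g.
Proof.
move=> /centralizesP C [h [a [b [Lh ab Eg]]]] [k [u [v [Lk uv Ef]]]].
pose G p := h * Lmul p * (Lmul b)^-1 * h^-1.
pose F q := k * Lmul q * (Lmul v)^-1 * k^-1.
(* [S p q] is the identity as soon as [p = b], where [G p] is trivial, or
   [q = v], where [F q] is. *)
pose S p q x := (G p)^-1 (F q (G p ((F q)^-1 x))).
have FE q (x : Q) : F q x = k (q *q (v \q k^-1 x)) by [].
have FVE q (x : Q) : (F q)^-1 x = k (v *q (q \q k^-1 x)) by [].
have GE p (x : Q) : G p x = h (p *q (b \q h^-1 x)) by [].
have GVE p (x : Q) : (G p)^-1 x = h (b *q (p \q h^-1 x)) by [].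
have Gb : G b = 1 by rewrite /G mulgK mulgV.
have Fv : F v = 1 by rewrite /F mulgK mulgV.
have Sb q x : S b q x = x by rewrite /S Gb [LHS](sym_invK (F q)).
have Sv p x : S p v x = x by rewrite /S Fv [LHS](sym_funK (G p)).
have m x : term_matrix beta b a (S b u x) (S b v x) (S a u x) (S a v x).
  have LkV := LMltV Lk; have LhV := LMltV Lh.
  have cc c := @tm_col beta b a _ _ (con_refl beta c).
  have row := tm_row beta b a; have col := @tm_col beta b a _ _ uv.
  rewrite /S !FVE !GE !FE !GVE.
  by do 8![apply: term_matrix_LMlt => //; try apply: tm_mul => //;
           try apply: tm_ldiv => //].
move=> x; have := C b a (con_sym ab) _ _ _ _ (m (f x)).
rewrite !Sb Sv => /(_ (con_refl _ _)).
have LG : LMlt (G a) by apply: (@Dis_gen_LMlt alpha); exists h, a, b.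
move=> /(LMlt_con LG).
rewrite /S -[F u]Ef -[G a]Eg [g (g^-1 _)]sym_invK.
by rewrite [f^-1 (f x)]sym_funK.
Qed.

Lemma centralizes_commute alpha beta delta f g :
    centralizes alpha beta delta ->
  norm_set (Dis alpha) g -> norm_set (Dis beta) f -> commute_mod delta f g.
Proof.
move=> C Ag Bf; apply: commute_mod_sym.
apply: commute_mod_generated Bf => [||f' Bf'].
- exact: norm_LMlt Ag.
- exact: Dis_gen_LMlt.
- apply: commute_mod_sym; apply: commute_mod_generated Ag => [||g' Ag'].
  + exact: Dis_gen_LMlt Bf'.
  + exact: Dis_gen_LMlt.
  + exact: centralizes_commute_gen C Ag' Bf'.
Qed.

Lemma centralizes_acts_trivially alpha beta delta :
    centralizes alpha beta delta ->
  norm_commutator (Dis alpha) (Dis beta) `<=` acts_trivially delta.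
Proof.
move=> C; apply: generated_sub.
  exact: (acts_trivially_subgroup (@con_refl _ delta) (@con_sym _ delta)
           (@con_trans _ delta)).
move=> _ [g Ag [f Bf <-]] x.
have Lgf : LMlt (f * g)^-1.
  by apply: LMltV; apply: LMltM; [apply: norm_LMlt Bf|apply: norm_LMlt Ag].
have := LMlt_con Lgf (con_sym (centralizes_commute C Ag Bf x)).
by rewrite [(f * g)^-1 (f (g x))](sym_funK (f * g)).
Qed.

Lemma con_commutatorE alpha beta : superconnected Q ->
  con_commutator alpha beta = con (norm_commutator (Dis alpha) (Dis beta)).
Proof.
move=> HQ; apply: con_eq => x y; split.
  exact: con_commutator_least (@con_norm_commutator_centralizes alpha beta) x y.
move=> xy delta C.
exact: con_sub HQ (centralizes_acts_trivially C) xy.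
Qed.

Lemma norm_commutatorC M N : norm_commutator M N = norm_commutator N M.
Proof.
have sub (A B : normal_subgroup Q) :
    norm_commutator A B `<=` norm_commutator B A.
  have [_ _ NV] := norm_subgroup (norm_commutator B A).
  apply: generated_sub; first exact: norm_subgroup.
  move=> _ [x Ax [y By <-]]; rewrite -invgR; apply: NV.
  by apply: sub_generated; exists y => //; exists x.
by apply: norm_eq; split; apply: sub.
Qed.

End LeftMultiplicationGroup.

Theorem proposition2p14 (Q : quandleType) (HQ : superconnected Q) :
  (forall alpha beta : congruence Q,
     [/\ alpha = con (Dis alpha),
         con_commutator alpha beta = con_commutator beta alpha
       & con_commutator alpha beta
         = con (norm_commutator (Dis alpha) (Dis beta))])
  /\
  (injective (fun alpha : congruence Q => Dis alpha)
   /\ (forall alpha : congruence Q,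
         exists N : normal_subgroup Q, con N = alpha)).
Proof.
split=> [alpha beta|].
  by rewrite con_Dis // !con_commutatorE // norm_commutatorC.
split=> [alpha beta /(congr1 (@con Q))|alpha]; first by rewrite !con_Dis.
by exists (Dis alpha); apply: con_Dis.
Qed.
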